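(* Let $\Gamma$ be a simplicial forest on the vertex set $\{x_1,\ldots,x_n\}$, let $\Bbbk$ be a field and $S=\Bbbk[x_1,\ldots,x_n]$. Then: (1) $\operatorname{pd}(S/\mathcal{F}(\Gamma))$ is the maximum cardinality of a well ordered facet cover of an induced subcollection of $\Gamma$. (2) $\operatorname{reg}(S/\mathcal{F}(\Gamma))$ is equal to the maximum of $\deg(\mathbf{m})-s$ taken over all squarefree monomials $\mathbf{m}\in S$ such that the vertex set of $\Gamma_{\mathbf{m}}$ is the set of all variables dividing $\mathbf{m}$, and all well ordered facet covers $F_1,\ldots,F_{s}$ of $\Gamma_{\mathbf{m}}$ (where $s$ is the cardinality of the cover). (3) All well ordered facet covers of a simplicial forest have the same cardinality.
   Context: A simplicial complex $\Gamma$ on a finite vertex set $V(\Gamma)$ is a set of subsets of $V(\Gamma)$ (faces), closed under taking subsets and containing all singletons $\{v\}$, $v\in V(\Gamma)$. Its facets are its inclusion-maximal faces. The simplicial complex generated by sets $F_1,\ldots,F_q$ (the facets, pairwise incomparable) is denoted $\langle F_1,\ldots,F_q\rangle$, and its vertices are the elements of $F_1\cup\cdots\cup F_q$. A subcollection of $\Gamma$ is a simplicial complex all of whose facets are facets of $\Gamma$. A facet $F$ of $\Gamma$ is a leaf if either $F$ is the only facet of $\Gamma$, or there is a facet $G\neq F$ of $\Gamma$ such that $F\cap H\subseteq G$ for every facet $H\neq F$ of $\Gamma$. $\Gamma$ is a simplicial forest if every nonempty subcollection of $\Gamma$ has a leaf. The facet ideal of $\Gamma$ is $\mathcal{F}(\Gamma)=(x_{i_1}\cdots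 x_{i_k} \mid \{x_{i_1},\ldots,x_{i_k}\}\text{ is a facet of }\Gamma)\subseteq S$. For a set $A$ of vertices of $\Gamma$, the induced subcollection is $\Gamma_A=\langle F \mid F \text{ a facet of } \Gamma,\ F\subseteq A\rangle$. A squarefree monomial $\mathbf{m}$ is identified with the set of variables dividing it, so $\Gamma_{\mathbf{m}}=\Gamma_A$ with $A$ the set of variables dividing $\mathbf{m}$. A set $D$ of facets of a simplicial complex $\Delta$ is a facet cover of $\Delta$ if every vertex of $\Delta$ belongs to some element of $D$; it is minimal if no proper subset of it is a facet cover of $\Delta$. A sequence $F_1,\ldots,F_k$ of (distinct) facets of $\Delta$ is a well ordered facet cover of $\Delta$, of cardinality $k$, if $\{F_1,\ldots,F_k\}$ is a minimal facet cover of $\Delta$ and for every facet $H\notin\{F_1,\ldots,F_k\}$ of $\Delta$ there exists $1\le i\leq k-1$ such that $F_i\subseteq H\cup F_{i+1}\cup F_{i+2}\cup\cdots\cup F_k$. With $b_{i,j}(S/I)$ the graded Betti numbers of $S/I$ (with $S$ in homological degree $0$ of the minimal free resolution), $\operatorname{pd}(S/I)=\max\{i\mid b_{i,j}(S/I)\neq 0\text{ for some }j\}$ and $\operatorname{reg}(S/I)=\max\{j-i\mid b_{i,j}(S/I)\neq 0\}$. *)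

(* Defs.v *)
From Stdlib Require Import ClassicalEpsilon.
From mathcomp Require Import all_boot all_order all_algebra.
From mathcomp Require Import mpoly.
Set Implicit Arguments.
Unset Strict Implicit.
Unset Printing Implicit Defensive.
Import Order.TTheory GRing.Theory Num.Theory.
Local Open Scope ring_scope.

Section SimplicialComplexes.

Variable T : finType.
Implicit Types (V A F G H : {set T}) (Gamma Delta D Fs : {set {set T}}).

(* The void complex set0 and the complex [set set0] are both allowed when V is
   empty; the generated complex << >> with no facet is the void one. *)
Definition simplicial_complex V Gamma : Prop :=
  [/\ forall F, F \in Gamma -> F \subset V,
      forall F G, F \in Gamma -> G \subset F -> G \in Gamma
    & forall v, v \in V -> [set v] \in Gamma].

Definition facets Gamma : {set {set T}} :=
  [set F : {set T} | maxset (mem Gamma) F].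

Definition generated Fs : {set {set T}} :=
  [set F : {set T} | [exists G in Fs, F \subset G]].

Definition vertices Gamma : {set T} := \bigcup_(F in facets Gamma) F.

Definition subcollection Delta Gamma : Prop :=
  simplicial_complex (vertices Delta) Delta
  /\ facets Delta \subset facets Gamma.

Definition leaf Gamma F : Prop :=
  F \in facets Gamma /\
  (facets Gamma = [set F] \/
   exists G, [/\ G \in facets Gamma, G != F
     & forall H, H \in facets Gamma -> H != F -> F :&: H \subset G]).

Definition simplicial_forest V Gamma : Prop :=
  simplicial_complex V Gamma /\
  (forall Delta, subcollection Delta Gamma -> Delta != set0 ->
     exists F, leaf Delta F).

Definition induced Gamma A : {set {set T}} :=
  generated [set F in facets Gamma | F \subset A].

Definition facet_cover Delta D : Prop :=
  D \subset facets Delta /\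
  (forall v, v \in vertices Delta -> exists2 F, F \in D & v \in F).

Definition minimal_facet_cover Delta D : Prop :=
  facet_cover Delta D /\
  (forall D', D' \proper D -> ~ facet_cover Delta D').

(* F_1, ..., F_k is the list s, so F_(i+1) is nth set0 s i. *)
Definition well_ordered_facet_cover Delta (s : seq {set T}) : Prop :=
  [/\ uniq s,
      minimal_facet_cover Delta [set F in s]
    & forall H, H \in facets Delta -> H \notin s ->
        exists2 i, (i.+1 < size s)%N
          & nth set0 s i \subset H :|: \bigcup_(G <- drop i.+1 s) G].

End SimplicialComplexes.

Definition is_maximum (d : Order.disp_t) (L : porderType d)
    (P : L -> Prop) (m : L) : Prop :=
  P m /\ forall x, P x -> (x <= m)%O.

Section BettiNumbers.

Variables (n : nat) (k : fieldType).
Local Notation S := {mpoly k[n]}.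

Definition facet_ideal (Gamma : {set {set 'I_n}}) (p : S) : Prop :=
  exists c : {set 'I_n} -> S,
    p = \sum_(F in facets Gamma) c F * \prod_(i in F) 'X_i.

(* The free module in homological degree i has rank [fr_rank i]; its r-th basis
   element has degree [fr_deg r], i.e. the module is the direct sum of the
   S(- fr_deg r). Elements are row vectors and [fr_diff i], acting on the right,
   goes from homological degree i+1 to i. [fr_aug] represents a map from degree 0
   to S/I by lifts to S of the images of the basis. *)
Record graded_free := GradedFree {
  fr_rank : nat -> nat;
  fr_deg : forall i, 'I_(fr_rank i) -> int;
  fr_aug : 'cV[S]_(fr_rank 0);
  fr_diff : forall i, 'M[S]_(fr_rank i.+1, fr_rank i)
}.

Definition degree_preserving (C : graded_free) : Prop :=
  (forall r m, m \in msupp (fr_aug C r 0) -> fr_deg r = (mdeg m)%:Z) /\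
  (forall i r c m, m \in msupp (fr_diff C i r c) ->
     fr_deg r = fr_deg c + (mdeg m)%:Z).

Definition resolves (I : S -> Prop) (C : graded_free) : Prop :=
  [/\ forall p : S, exists v : 'rV[S]_(fr_rank C 0),
        I (p - (v *m fr_aug C) 0 0),
      forall v : 'rV[S]_(fr_rank C 0),
        I ((v *m fr_aug C) 0 0) <-> exists w, v = w *m fr_diff C 0
    & forall i (v : 'rV[S]_(fr_rank C i.+1)),
        v *m fr_diff C i = 0 <-> exists w, v = w *m fr_diff C i.+1].

(* The image of each differential lies in (x_1, ..., x_n) times its target. *)
Definition minimal (C : graded_free) : Prop :=
  forall i r c, (fr_diff C i r c)@_0%MM = 0.

Definition minimal_graded_free_resolution (I : S -> Prop) (C : graded_free) :=
  [/\ degree_preserving C, resolves I C & minimal C].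

(* b_(i,j)(S/I): the multiplicity of S(-j) in homological degree i of a minimal
   graded free resolution of S/I. For a homogeneous ideal I such a resolution
   exists and this number does not depend on its choice. *)
Definition betti (I : S -> Prop) (i : nat) (j : int) : nat :=
  epsilon (inhabits 0%N) (fun b => exists C : graded_free,
    minimal_graded_free_resolution I C
    /\ b = #|[set r : 'I_(fr_rank C i) | fr_deg r == j]|).

(* Relations rather than functions: if I is the unit ideal then S/I = 0, all
   Betti numbers vanish, and neither maximum exists. *)
Definition is_pd (I : S -> Prop) (p : nat) : Prop :=
  is_maximum (fun i => exists j, betti I i j <> 0%N) p.

Definition is_reg (I : S -> Prop) (r : int) : Prop :=
  is_maximum (fun q => exists i j, betti I i j <> 0%N /\ q = j - i%:Z) r.

End BettiNumbers.

Arguments facet_ideal {n} k Gamma p.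

Definition squarefree (n : nat) (m : 'X_{1..n}) : Prop :=
  forall i, (m i <= 1)%N.

Definition mvars (n : nat) (m : 'X_{1..n}) : {set 'I_n} :=
  [set i | (0 < m i)%N].

(* Main.v *)
From Stdlib Require Import ClassicalEpsilon.
Require Import Defs.
From mathcomp Require Import all_boot all_order all_algebra.
From mathcomp Require Import mpoly.
Import Order.TTheory GRing.Theory Num.Theory.
Local Open Scope ring_scope.

Set Implicit Arguments.
Unset Strict Implicit.
Unset Printing Implicit Defensive.

(** A leaf F of an antichain of nonempty sets has a vertex v lying in no other
    member: any vertex if F is alone, and otherwise any vertex outside its joint.
    Write I for the facet ideal, J for the ideal of the members other than F, and
    m_F for the monomial of F. Then J : m_F is generated by the monomials of the sets H \ F, and S/I
    is the cokernel of multiplication by m_F from S/(J : m_F) to S/J, which is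
    injective. So the mapping cone of a lift of this multiplication resolves
    S/I. As v occurs in no other generator, the monomial of F \ {v} already maps
    J : m_F into J; lifting that map and multiplying by x_v gives a lift all of
    whose entries are multiples of x_v, so the cone of two minimal resolutions
    is minimal. Deleting F and contracting F (passing to the sets H \ F) both
    preserve the leaf property, hence this describes a minimal resolution by
    induction: a generator for the family is a generator for the deletion, or a
    generator for the contraction moved up by one homological degree and |F|
    internal degrees ([forest_resolution]).

    Well ordered facet covers obey the same recursion. Consider covers of a
    vertex set A by members contained in A. If F is not contained in A, they are
    covers for the deletion. If it is, F must be used, since nothing else covers
    v; it may be moved to the end of the sequence, since it can never be the
    member that the ordering condition asks for; and removing F from everything
    turns the cover into one of A \ F for the contraction, one member shorter
    ([covered_rec]). The contraction need not be an antichain, but only its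
    minimal members matter, for covers ([covered_min]) as for ideals
    ([monomial_ideal_min]).

    Therefore the generators in homological degree i have as degrees the
    cardinalities of the sets A with a well ordered cover of i members. The
    same recursion shows that A determines i ([covered_size_unique]), which is
    the last claim. The first two follow because the degrees that occur
    in a minimal resolution do not depend on the resolution
    ([minimal_resolution_degree]): comparison maps in both directions compose to
    the identity up to homotopy, hence exactly modulo the variables. *)

(** * Well ordered covers of families of sets *)

Local Open Scope nat_scope.

Section Covers.

Variable T : finType.
Implicit Types (A B F G H X Y : {set T}) (FF GG : {set {set T}}) (s t : seq {set T}).

Local Notation cup s := (\bigcup_(G <- s) G).

Lemma in_cup x s : reflect (exists2 G, G \in s & x \in G) (x \in cup s).
Proof.
elim: s => [|G s IH]; first by rewrite big_nil inE; constructor; case.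
rewrite big_cons inE; apply: (iffP orP) => [[xG|/IH[H Hs xH]]|[H]].
- by exists G; rewrite ?mem_head.
- by exists H; rewrite // inE Hs orbT.
by rewrite inE => /orP[/eqP->|Hs] xH; [left | right; apply/IH; exists H].
Qed.

Lemma mem_cup G s : G \in s -> G \subset cup s.
Proof. by move=> Gs; apply/subsetP => x xG; apply/in_cup; exists G. Qed.

(** The ordering condition of a well ordered cover, without the requirement that
    the absorbed member not be the last one, and for X possibly in s. Both
    relaxations are harmless in an antichain ([well_orderedP]), and they make the
    condition monotone in X and true of every X containing a member of s. *)
Fixpoint absorbed X s : bool :=
  if s is G :: s' then (G \subset X :|: cup s') || absorbed X s' else false.

Lemma absorbed_mono X Y s : X \subset Y -> absorbed X s -> absorbed Y s.
Proof.
move=> sXY; elim: s => //= G s IH /orP[h|/IH->]; last by rewrite orbT.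
by rewrite (subset_trans h) // setSU.
Qed.

Lemma absorbed_mem G X s : G \in s -> G \subset X -> absorbed X s.
Proof.
move=> + sGX; elim: s => //= H s IH; rewrite inE => /orP[/eqP<-|/IH->].
  by rewrite (subset_trans sGX) ?subsetUl.
by rewrite orbT.
Qed.

Lemma absorbedP X s :
  reflect (exists2 i, i < size s
             & nth set0 s i \subset X :|: cup (drop i.+1 s))
    (absorbed X s).
Proof.
elim: s => [|G s IH] /=; first by constructor; case.
apply: (iffP orP) => [[h|/IH[i lti h]]|[[|i] lti h]].
- by exists 0; rewrite //= drop0.
- by exists i.+1.
- by left; rewrite /= drop0 in h.
by right; apply/IH; exists i.
Qed.

(** Minimality of a cover, by means of a private element of each member; this form
    is easy to carry through replacements and contractions. *)
Definition irredundant s : Prop :=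
  forall F, F \in s -> exists2 x, x \in F & forall G, G \in s -> x \in G -> G = F.

(** A well ordered cover by members of FF of its own union. Only the members of
    FF inside that union are constrained, so the induced subfamily need not be
    mentioned. *)
Definition ordered_cover FF s : Prop :=
  [/\ uniq s, {subset s <= FF}, irredundant s
    & forall H, H \in FF -> H \subset cup s -> absorbed H s].

Definition covered FF i A : Prop :=
  exists s, [/\ ordered_cover FF s, cup s = A & size s = i].

(** The absorbed member would have its private element in a later member. *)
Lemma not_absorbed0 s : irredundant s -> uniq s -> ~~ absorbed set0 s.
Proof.
move=> irr us; apply/negP => /absorbedP[i lti h].
have [x xF px] := irr _ (mem_nth set0 lti).
have := subsetP h _ xF; rewrite !inE => /in_cup[G Gd xG].
have eG := px _ (mem_drop Gd) xG; move: Gd; rewrite eG.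
move: us; rewrite -{1}(cat_take_drop i s) (drop_nth set0) // cat_uniq /=.
by case/and3P=> _ _ /andP[/negP].
Qed.

(** The counterpart for covers of S/I being zero when I is the unit ideal: the
    empty member would have to be absorbed. *)
Lemma covered_empty_edge FF i A : set0 \in FF -> ~ covered FF i A.
Proof.
move=> F0 [s [[us _ irr abs] _ _]].
by move: (abs _ F0 (sub0set _)); apply/negP/not_absorbed0.
Qed.

Definition min_edges FF := [set F in FF | [forall G in FF, (G \subset F) ==> (G == F)]].

Lemma min_edgesP FF F :
  reflect (F \in FF /\ forall G, G \in FF -> G \subset F -> G = F) (F \in min_edges FF).
Proof.
rewrite inE; apply: (iffP andP) => -[FF_F].
  by move/forall_inP=> h; split=> // G GF sGF; apply/eqP; apply: (implyP (h _ GF)).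
by move=> h; split=> //; apply/forall_inP => G GF; apply/implyP => /(h _ GF)/eqP.
Qed.

Lemma min_edges_below FF H : H \in FF -> exists2 G, G \in min_edges FF & G \subset H.
Proof.
move=> HF; case: (@minset_exists _ (mem FF) H HF) => G /minsetP[GF minG] sGH.
by exists G => //; apply/min_edgesP; split.
Qed.

(** A member absorbs whatever one of its minimal submembers absorbs. *)
Lemma covered_of_min FF i A : covered (min_edges FF) i A -> covered FF i A.
Proof.
case=> s [[us sF irr abs] cs ss]; exists s; split=> //; split=> //.
  by move=> F /sF /min_edgesP[].
move=> H /min_edges_below[G Gm sGH] sHc.
exact: absorbed_mono sGH (abs _ Gm (subset_trans sGH sHc)).
Qed.

(** No member other than F can be absorbed by a subset H of F: its private element
    would lie in F or in a later member. *)
Lemma absorbed_self F H s : irredundant s -> uniq s ->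
  F \in s -> H \subset F -> absorbed H s ->
  exists s1 s2, s = s1 ++ F :: s2 /\ F \subset H :|: cup s2.
Proof.
move=> irr us Fs sHF /absorbedP[i lti h].
have es : s = take i s ++ nth set0 s i :: drop i.+1 s.
  by rewrite -(drop_nth set0 lti) cat_take_drop.
set F' := nth set0 s i in h es.
have F's : F' \in s by apply: mem_nth.
have ni : F' \notin drop i.+1 s.
  by move: us; rewrite {1}es cat_uniq /= => /and3P[_ _ /andP[]].
have [e|nF] := eqVneq F' F.
  by exists (take i s), (drop i.+1 s); rewrite -e.
have [x xF' px] := irr _ F's.
have := subsetP h _ xF'; rewrite inE => /orP[/(subsetP sHF) xF|/in_cup[G Gd xG]].
  by move: nF; rewrite (px _ Fs xF) eqxx.
by move: ni; rewrite -(px _ (mem_drop Gd) xG) Gd.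
Qed.

(** Exchanging F for H changes no union of a tail that contains it, as F is
    covered by H and what follows. *)
Lemma absorbed_replace F H X s1 s2 :
  H \subset F -> F \subset H :|: cup s2 ->
  absorbed X (s1 ++ F :: s2) -> absorbed X (s1 ++ H :: s2).
Proof.
move=> sHF sF.
have scup : forall s1, cup (s1 ++ F :: s2) = cup (s1 ++ H :: s2).
  move=> s; rewrite !big_cat !big_cons /=; congr (_ :|: _).
  apply/eqP; rewrite eqEsubset (setSU _ sHF) andbT.
  by rewrite subUset sF subsetUr.
elim: s1 => [|G s1 IH] /=; last first.
  by rewrite scup => /orP[->//|/IH->]; rewrite orbT.
by case/orP=> [h|->]; rewrite ?orbT // (subset_trans sHF).
Qed.

(** The private element of F lies in H, since the members after F do not contain
    it; the other private elements are unaffected because H is inside F. *)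
Lemma ordered_cover_replace FF F H s1 s2 :
  let s := s1 ++ F :: s2 in let s' := s1 ++ H :: s2 in
  ordered_cover FF s -> H \in FF -> H \proper F -> F \subset H :|: cup s2 ->
  ordered_cover FF s' /\ cup s' = cup s.
Proof.
move=> s s' [us sFF irr abs] HF pHF sF; have sHF := proper_sub pHF.
have Fs : F \in s by rewrite mem_cat mem_head orbT.
have us' : perm_eq s (F :: s1 ++ s2) by rewrite /s -[F :: s2]cat1s perm_catCA.
have [FnR uR] : F \notin s1 ++ s2 /\ uniq (s1 ++ s2).
  by move: us; rewrite (perm_uniq us') /= => /andP[].
have memR G : (G \in s) = (G == F) || (G \in s1 ++ s2).
  by rewrite (perm_mem us').
have memR' G : (G \in s') = (G == H) || (G \in s1 ++ s2).
  by rewrite !(mem_cat, inE); do !case: (_ \in _) => //=; rewrite ?orbT ?orbF.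
have Hns : H \notin s1 ++ s2.
  apply/negP => Hs; have [|x xH px] := irr H; first by rewrite memR Hs orbT.
  have := px F Fs (subsetP sHF _ xH) => e.
  by move: pHF; rewrite e properxx.
have ecup : cup s' = cup s.
  rewrite /s /s' !big_cat !big_cons /=; congr (_ :|: _).
  apply/eqP; rewrite eqEsubset (setSU _ sHF) /=.
  by rewrite subUset sF subsetUr.
split=> //; split.
- have /perm_uniq-> : perm_eq s' (H :: s1 ++ s2).
    by rewrite /s' -[H :: s2]cat1s perm_catCA.
  by rewrite /= Hns.
- move=> G; rewrite memR' => /orP[/eqP->//|Gs].
  by apply: sFF; rewrite memR Gs orbT.
- move=> G; rewrite memR' => /orP[/eqP {G}->|Gs]; last first.
    have [|x xG px] := irr G; first by rewrite memR Gs orbT.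
    exists x => // G'; rewrite memR' => /orP[/eqP->|G's] xG'; last first.
      by apply: px => //; rewrite memR G's orbT.
    by move: FnR; rewrite (px F Fs (subsetP sHF _ xG')) Gs.
  have [x xF px] := irr F Fs; exists x.
    move: (subsetP sF _ xF); rewrite inE => /orP[//|/in_cup[K Ks xK]].
    have KR : K \in s1 ++ s2 by rewrite mem_cat Ks orbT.
    by move: FnR; rewrite -(px K _ xK) ?KR // memR KR orbT.
  move=> K; rewrite memR' => /orP[/eqP//|Ks xK].
  by move: FnR; rewrite -(px K _ xK) ?Ks // memR Ks orbT.
move=> G GF sG; apply: absorbed_replace sHF sF _.
by apply: abs => //; rewrite -ecup.
Qed.

(** A member F of the cover containing a smaller member H of the family can be
    exchanged for H: the ordering condition for H can only concern F
    ([absorbed_self]), which is what the exchange needs. The total size of the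
    members decreases, so repeating this ends with minimal members. *)
Lemma covered_to_min FF i A : covered FF i A -> covered (min_edges FF) i A.
Proof.
case=> s; have [w] := ubnP (\sum_(F <- s) #|F|); elim: w s => // w IH s ltw.
case=> os cs ss; have [us sF irr abs] := os.
have [/allP hs|/allPn[F Fs Fnm]] := boolP (all (fun F => F \in min_edges FF) s).
  exists s; split=> //; split=> // H /min_edgesP[HF _]; exact: abs.
have [H Hm sHF] := min_edges_below (sF _ Fs).
have HF : H \in FF by case/min_edgesP: Hm.
have pHF : H \proper F.
  by rewrite properEneq sHF andbT; apply: contraNneq Fnm => <-.
have sHc : H \subset cup s by apply: subset_trans sHF (mem_cup Fs).
have [s1 [s2 [es sFH]]] := absorbed_self irr us Fs sHF (abs _ HF sHc).
subst s.
have [os' cs'] := ordered_cover_replace os HF pHF sFH.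
apply: (IH (s1 ++ H :: s2)); last by rewrite cs' cs; split=> //; rewrite -ss !size_cat.
rewrite -ltnS; apply: leq_trans ltw; rewrite ltnS !big_cat !big_cons /=.
by rewrite ltn_add2l ltn_add2r proper_card.
Qed.

Lemma covered_min FF i A : covered FF i A <-> covered (min_edges FF) i A.
Proof. by split; [apply: covered_to_min | apply: covered_of_min]. Qed.

Definition contract FF F := [set H :\: F | H in FF :\ F].

Definition free_vertex FF F v := v \in F /\ forall H, H \in FF -> v \in H -> H = F.

Lemma cup_setD F t : cup [seq H :\: F | H <- t] = cup t :\: F.
Proof.
elim: t => [|G t IH]; first by rewrite !big_nil set0D.
by rewrite /= !big_cons IH setDUl.
Qed.

Lemma absorbed_setD F X t :
  absorbed (X :\: F) [seq H :\: F | H <- t] = absorbed (X :|: F) t.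
Proof.
elim: t => //= G t ->; congr (_ || _).
rewrite cup_setD -setDUl subDset.
rewrite (_ : F :|: _ = X :|: F :|: cup t) //; apply/setP => x; rewrite !inE.
by case: (x \in F); rewrite ?orbT ?orbF.
Qed.

(** A member F that is never the absorbed one can be moved to the end, where it
    helps to absorb all the others. *)
Lemma absorbed_move_last F X s1 s2 :
  ~~ (F \subset X :|: cup s2) ->
  absorbed X (s1 ++ F :: s2) -> absorbed (X :|: F) (s1 ++ s2).
Proof.
move=> nF; elim: s1 => [|G s1 IH] /=.
  by rewrite (negPf nF) /=; apply: absorbed_mono; rewrite subsetUl.
case/orP => [h|/IH->]; last by rewrite orbT.
rewrite (subset_trans h) // !big_cat big_cons /=.
by rewrite -!setUA setUS // setUCA.
Qed.

Lemma absorbed_rcons F X t : absorbed (X :|: F) t -> absorbed X (rcons t F).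
Proof.
elim: t => //= G t IH /orP[h|/IH->]; last by rewrite orbT.
by rewrite (subset_trans h) // -cats1 big_cat big_seq1 /= -setUA (setUC F).
Qed.

Lemma covered_without FF F v i A :
  free_vertex FF F v -> covered (FF :\ F) i A -> covered FF i A.
Proof.
move=> [vF fv] [s [[us sF irr abs] cs ss]]; exists s; split=> //; split=> //.
  by move=> G /sF /setD1P[].
move=> H HF sHc; apply: abs => //; rewrite !inE HF andbT.
apply: contraTneq sHc => ->; apply/subsetPn; exists v => //.
by apply/in_cup => -[G /sF /setD1P[nGF GF] /(fv _ GF)/eqP]; apply/negP.
Qed.

Lemma uniq_map_inj (S S' : eqType) (f : S -> S') (s : seq S) :
  uniq [seq f x | x <- s] -> {in s &, injective f}.
Proof.
elim: s => //= a s IH /andP[nfa us] x y; rewrite !inE.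
case/orP=> [/eqP->|xs] /orP[/eqP->|ys] // e; last exact: IH.
  by move: nfa; rewrite e map_f.
by move: nfa; rewrite -e map_f.
Qed.

(** Lift the members of a cover of the contraction to the family and put F last:
    F then helps to absorb every other member, and v is its private element. *)
Lemma covered_extend FF F v i B :
  free_vertex FF F v -> F \in FF -> covered (contract FF F) i B ->
  [disjoint F & B] /\ covered FF i.+1 (F :|: B).
Proof.
move=> [vF fv] FFF [s [[us sF irr abs] cs ss]].
have {sF}[t tF st] : exists2 t, {subset t <= FF :\ F} & s = [seq H :\: F | H <- t].
  elim: s sF {us irr abs cs ss} => [|G s IH] sF; first by exists [::].
  have [|t tF ->] := IH; first by move=> H Hs; apply: sF; rewrite inE Hs orbT.
  have /imsetP[H HF ->] := sF G (mem_head _ _).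
  by exists (H :: t) => // K; rewrite inE => /orP[/eqP->//|/tF].
subst s; have ut := map_uniq us; rewrite size_map cup_setD in cs ss.
have injt := uniq_map_inj us.
have cFt : cup (rcons t F) = F :|: (cup t :\: F).
  rewrite -cats1 big_cat big_seq1 /=; apply/setP => x; rewrite !inE.
  by case: (x \in F); rewrite ?orbT ?orbF.
split.
  by rewrite -cs disjoint_sym disjoints_subset; apply/subsetP => x; rewrite !inE => /andP[].
exists (rcons t F); rewrite cFt cs size_rcons ss; split=> //; split.
- by rewrite rcons_uniq ut andbT; apply: contraTN isT => /tF; rewrite setD11.
- by move=> G; rewrite mem_rcons inE => /orP[/eqP->//|/tF/setD1P[]].
- move=> G; rewrite mem_rcons inE => /orP[/eqP->|Gt].
    exists v => // H; rewrite mem_rcons inE => /orP[/eqP//|/tF/setD1P[_ HF]].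
    exact: fv.
  have [x] := irr _ (map_f _ Gt); rewrite inE => /andP[xF xG] px.
  exists x => // H; rewrite mem_rcons inE => /orP[/eqP->|Ht] xH.
    by rewrite xH in xF.
  apply: injt => //; apply: px; first exact: (map_f (fun K => K :\: F)).
  by rewrite inE xF.
- move=> H HF sH; have [->|nHF] := eqVneq H F.
    by apply: (absorbed_mem (G := F)); rewrite // mem_rcons mem_head.
  apply: absorbed_rcons; rewrite -absorbed_setD.
  apply: abs; first by apply: imset_f; rewrite !inE nHF.
  rewrite cup_setD subDset.
  by move: sH; rewrite cFt.
Qed.

(** Only F can cover v, so F is in the cover, and v prevents F from ever
    being the absorbed member; hence F can be moved last and divided out. *)
Lemma covered_contract FF F v i A :
  free_vertex FF F v -> F \in FF -> F \subset A -> covered FF i A ->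
  exists i' B, [/\ i = i'.+1, A = F :|: B, [disjoint F & B] & covered (contract FF F) i' B].
Proof.
move=> [vF fv] FFF sFA [s [[us sF irr abs] cs ss]].
have Fs : F \in s.
  have /in_cup[G Gs vG] : v \in cup s by rewrite cs (subsetP sFA).
  by rewrite -(fv _ (sF _ Gs) vG).
have [s1 [s2 es]] : exists s1 s2, s = s1 ++ F :: s2.
  by case/splitPr: {us sF irr abs cs ss} Fs => s1 s2; exists s1, s2.
pose t := s1 ++ s2.
have ps : perm_eq s (F :: t) by rewrite es -[F :: s2]cat1s perm_catCA.
have [Ft ut] : F \notin t /\ uniq t by move: us; rewrite (perm_uniq ps) => /andP[].
have ms G : G \in s = (G == F) || (G \in t) by rewrite (perm_mem ps) inE.
have ts G : G \in t -> G \in s by rewrite ms => ->; rewrite orbT.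
have tF G : G \in t -> G \in FF :\ F.
  by move=> Gt; rewrite !inE sF ?ts // andbT; apply: contraNneq Ft => <-.
have priv G : G \in t ->
    exists2 x, x \in G :\: F & forall H, H \in t -> x \in H -> H = G.
  move=> Gt; have [x xG px] := irr _ (ts _ Gt); exists x.
    by rewrite inE xG andbT; apply: contraNN Ft => /(px _ Fs)->.
  by move=> H /ts; apply: px.
have cA : A = F :|: (cup t :\: F).
  rewrite -cs es big_cat big_cons /t big_cat /=; apply/setP => x; rewrite !inE.
  by case: (x \in F); rewrite ?orbT ?orbF.
exists (size t), (cup t :\: F); split=> //.
- by rewrite -ss (perm_size ps).
- by rewrite disjoint_sym disjoints_subset; apply/subsetP => x; rewrite !inE => /andP[].
exists [seq H :\: F | H <- t]; rewrite cup_setD size_map; split=> //; split.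
- rewrite map_inj_in_uniq // => G H Gt Ht eGH.
  have [x xG px] := priv _ Gt; symmetry; apply: px => //.
  by move: xG; rewrite eGH inE => /andP[].
- by move=> _ /mapP[G /tF GF ->]; apply: imset_f.
- move=> _ /mapP[G Gt ->]; have [x xG px] := priv _ Gt; exists x => //.
  by move=> _ /mapP[H Ht ->]; rewrite inE => /andP[_ /(px _ Ht)->].
move=> _ /imsetP[H /setD1P[nHF HF] ->]; rewrite cup_setD => sH.
rewrite absorbed_setD; apply: absorbed_move_last; last rewrite -es.
  apply/subsetPn; exists v => //; rewrite inE negb_or; apply/andP; split.
    by apply: contraNN nHF => /(fv _ HF)->.
  apply/in_cup => -[G Gs2 vG]; have Gt : G \in t by rewrite mem_cat Gs2 orbT.
  by move: Ft; rewrite -(fv _ _ vG) ?Gt // sF // ts.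
apply: abs => //; rewrite cs cA; apply/subsetP => x xH; rewrite in_setU.
case: (boolP (x \in F)) => //= nxF; apply: (subsetP sH).
by rewrite inE nxF.
Qed.

Lemma covered_rec FF F v i A :
  free_vertex FF F v -> F \in FF ->
  covered FF i A <->
  covered (FF :\ F) i A \/
  exists i' B, [/\ i = i'.+1, A = F :|: B, [disjoint F & B]
                & covered (contract FF F) i' B].
Proof.
move=> fv FFF; split=> [cF|[/(covered_without fv)//|]]; last first.
  by case=> [i' [B [-> -> _ cB]]]; have [] := covered_extend fv FFF cB.
have [sFA|nFA] := boolP (F \subset A); first by right; apply: covered_contract fv _ _ _.
left; case: cF => s [[us sF irr abs] cs ss]; exists s; split=> //; split=> //.
  move=> G Gs; rewrite !inE sF // andbT; apply: contraNneq nFA => <-.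
  by rewrite -cs mem_cup.
by move=> H /setD1P[_]; apply: abs.
Qed.

(** * Families with the leaf property *)

(** The notion of leaf of a complex, in terms of the family of its facets. *)
Definition leaf_edge FF F :=
  F \in FF /\ (FF = [set F] \/ exists G, [/\ G \in FF, G != F
     & forall H, H \in FF -> H != F -> F :&: H \subset G]).

Definition forest FF := forall GG, GG \subset FF -> GG != set0 -> exists F, leaf_edge GG F.

Lemma forestS FF GG : GG \subset FF -> forest FF -> forest GG.
Proof. by move=> sGF fF HH sHG; apply: fF; apply: subset_trans sGF. Qed.

(** The members of a subfamily of the restriction come from distinct members of
    FF; these form a subfamily with a leaf, whose defining inclusions survive
    the removal of W. *)
Lemma forest_setD FF W : forest FF -> forest [set H :\: W | H in FF].
Proof.
move=> fF GG sGG GG0.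
pose pre G := odflt set0 [pick H in FF | H :\: W == G].
have preP G : G \in GG -> pre G \in FF /\ pre G :\: W = G.
  move=> GGG; rewrite /pre; case: pickP => [H /andP[HF /eqP]//|].
  by have /imsetP[H HF ->] := subsetP sGG _ GGG => /(_ H); rewrite HF eqxx.
have [||F [/imsetP[F0 F0G ->] lF]] := fF (pre @: GG).
- by apply/subsetP => _ /imsetP[G /preP[GF _] ->].
- by case/set0Pn: GG0 => G GG_G; apply/set0Pn; exists (pre G); apply: imset_f.
have pinj : {in GG &, injective pre}.
  by move=> G H /preP[_ {2}<-] /preP[_ {2}<-] ->.
exists F0; split=> //; case: lF => [e|[_ [/imsetP[G GG_G ->] nGF lF]]].
  left; apply/setP => G; rewrite inE; apply/idP/eqP => [GG_G|-> //].
  apply: pinj => //; apply/set1P; rewrite -e; exact: imset_f.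
right; exists G; split=> // [|H HG nHF]; first by apply: contraNneq nGF => ->.
have := lF (pre H); rewrite imset_f // => /(_ isT).
rewrite (inj_in_eq pinj) // => /(_ nHF) /(setSD W).
rewrite setDIl; have [_ ->] := preP _ F0G; have [_ ->] := preP _ HG.
by have [_ ->] := preP _ GG_G.
Qed.

(** If F is not the only member, it is not contained in its joint G; a vertex v of F outside G is in no other
    member, since F meets these inside G. *)
Lemma forest_free_vertex FF :
  forest FF -> (forall F G, F \in FF -> G \in FF -> F \subset G -> F = G) ->
  set0 \notin FF -> FF != set0 -> exists F v, F \in FF /\ free_vertex FF F v.
Proof.
move=> fF anti F0 FF0; have [F [FFF lF]] := fF _ (subxx _) FF0.
exists F; case: lF => [e|[G [GF nGF lF]]].
  have /set0Pn[v vF] : F != set0 by apply: contraNneq F0 => <-.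
  by exists v; split=> //; split=> // H; rewrite e => /set1P.
have /subsetPn[v vF vG] : ~~ (F \subset G).
  by apply: contraNN nGF => /(anti _ _ FFF GF)->.
exists v; split=> //; split=> // H HF vH; apply/eqP; apply: contraNT vG => nHF.
by apply: (subsetP (lF _ HF nHF)); rewrite inE vF.
Qed.

Lemma min_edges_sub FF : min_edges FF \subset FF.
Proof. by apply/subsetP => F /min_edgesP[]. Qed.

Lemma min_edges_anti FF F G :
  F \in min_edges FF -> G \in min_edges FF -> F \subset G -> F = G.
Proof. by move=> /min_edgesP[FF_F _] /min_edgesP[_]; apply. Qed.

Lemma min_edges_neq0 FF : FF != set0 -> min_edges FF != set0.
Proof.
by case/set0Pn => F /min_edges_below[G Gm _]; apply/set0Pn; exists G.
Qed.

Lemma card_contract FF F : F \in FF -> #|contract FF F| < #|FF|.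
Proof.
move=> FFF; apply: leq_ltn_trans (leq_imset_card _ _) _.
by rewrite [X in _ < X](cardsD1 F) FFF.
Qed.

Lemma forest_elimination FF :
  forest FF -> set0 \notin FF -> FF != set0 ->
  exists F v, [/\ F \in min_edges FF, free_vertex (min_edges FF) F v,
    forest (min_edges FF :\ F), forest (contract (min_edges FF) F) &
    #|min_edges FF :\ F| < #|FF| /\ #|contract (min_edges FF) F| < #|FF|].
Proof.
move=> fF F0 FF0; have smin := min_edges_sub FF.
have fm : forest (min_edges FF) by apply: forestS fF.
have [|F [v [Fm fv]]] := forest_free_vertex fm (@min_edges_anti FF) _ (min_edges_neq0 FF0).
  by apply: contraNN F0; apply: (subsetP smin).
have fd : forest (min_edges FF :\ F) by apply: forestS fm; apply: subD1set.
exists F, v; split=> //; first exact: forest_setD.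
split; apply: leq_trans (subset_leq_card smin); last exact: card_contract.
by rewrite [X in _ < X](cardsD1 F) Fm.
Qed.

(** Whether A contains v decides which alternative of [covered_rec] holds, and in
    the second one the cover of the contraction is that of A \ F. *)
Lemma covered_size_unique FF A i j :
  forest FF -> covered FF i A -> covered FF j A -> i = j.
Proof.
have [m] := ubnP #|FF|; elim: m FF A i j => // m IH FF A i j ltm fF.
have [F0|F0] := boolP (set0 \in FF); first by move/(covered_empty_edge F0).
have [->|FF0] := eqVneq FF set0.
  move=> [s [[_ sF _ _] _ <-]] [t [[_ tF _ _] _ <-]].
  case: s sF => [_|G s /(_ G (mem_head _ _))]; last by rewrite inE.
  by case: t tF => [//|G t /(_ G (mem_head _ _))]; rewrite inE.
have [F [v [Fm fv fd fc [ltd ltc]]]] := forest_elimination fF F0 FF0.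
have out i' : covered (min_edges FF :\ F) i' A -> v \notin A.
  case=> s [[_ sF _ _] <- _]; apply/in_cup => -[G /sF/setD1P[nGF Gm] vG].
  by case: fv => _ /(_ _ Gm vG) /eqP; apply/negP.
have vF : v \in F by case: fv.
move=> /covered_min/(covered_rec _ _ fv Fm)[ci|[i' [B [-> eB dB ci]]]];
move=> /covered_min/(covered_rec _ _ fv Fm)[cj|[j' [C [-> eC dC cj]]]].
- by apply: IH ci cj => //; apply: leq_trans ltd _.
- by move: (out _ ci); rewrite eC inE vF.
- by move: (out _ cj); rewrite eB inE vF.
congr _.+1; apply: IH (ci) _ => //; first by apply: leq_trans ltc _.
suff -> : B = C by [].
apply/setP => x; move: eB; rewrite eC => /setP/(_ x); rewrite !inE.
have := disjointFr dB (x := x); have := disjointFr dC (x := x).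
by case: (x \in F) => /= [-> // -> //|].
Qed.

End Covers.

Local Open Scope ring_scope.

(** * Homogeneous polynomials, chain maps and uniqueness of degrees *)

Section Homogeneous.

Variables (n : nat) (k : fieldType).
Local Notation S := {mpoly k[n]}.
Implicit Types (p q : S) (z e : int).

Definition homogeneous z p : Prop := forall m, m \in msupp p -> z = (mdeg m)%:Z.

(** Degrees are integers because those of a resolution are; there is nothing in
    negative degrees. *)
Definition hcomp z p : S := if z is Posz d then pihomog mdeg d p else 0.

Lemma mcoeff_hcomp z p m : (hcomp z p)@_m = if z == (mdeg m)%:Z then p@_m else 0.
Proof.
case: z => d; last by rewrite /= mcoeff0.
rewrite /hcomp -[_ == _]/(d == mdeg m) {1}[p]mpolyE.
rewrite (raddf_sum (pihomog mdeg d)) (raddf_sum (mcoeff m)).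
rewrite [X in _ = if _ then X@__ else _]mpolyE (raddf_sum (mcoeff m)).
rewrite (eq_bigr (fun m' => if d == mdeg m then p@_m' * 'X_[m']@_m else 0)).
  by case: ifP => _; [apply: eq_bigr => m' _; rewrite /= mcoeffZ | rewrite big1].
move=> m' _; rewrite /= [pihomog _ _ _]linearZ /= mcoeffZ pihomogX.
have [->|nm] := eqVneq m' m; first by rewrite eq_sym; case: eqP => //; rewrite mcoeff0 mulr0.
by case: (mdeg m' == d); rewrite ?mcoeff0 ?mcoeffX (negPf nm) ?mulr0 if_same.
Qed.

Lemma hcomp_homogeneous z p : homogeneous z (hcomp z p).
Proof.
by move=> m; rewrite mcoeff_msupp mcoeff_hcomp; case: (z =P _) => //=; rewrite eqxx.
Qed.

Lemma hcomp_id z p : homogeneous z p -> hcomp z p = p.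
Proof.
move=> hp; apply/mpolyP => m; rewrite mcoeff_hcomp; case: eqP => // nz.
by apply/esym/eqP; rewrite mcoeff_eq0; apply/negP => /hp.
Qed.

Lemma hcomp_neq z z' p : homogeneous z' p -> z' != z -> hcomp z p = 0.
Proof.
move=> hp nz; apply/mpolyP => m; rewrite mcoeff_hcomp mcoeff0; case: eqP => // e.
by apply/eqP; rewrite mcoeff_eq0; apply: contra nz => /hp->; rewrite e.
Qed.

Lemma hcomp0 z : hcomp z 0 = 0.
Proof. by apply/mpolyP => m; rewrite mcoeff_hcomp mcoeff0 if_same. Qed.

Lemma hcompD z p q : hcomp z (p + q) = hcomp z p + hcomp z q.
Proof.
by apply/mpolyP => m; rewrite !(mcoeffD, mcoeff_hcomp); case: ifP; rewrite ?addr0.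
Qed.

Lemma hcompN z p : hcomp z (- p) = - hcomp z p.
Proof.
by apply/mpolyP => m; rewrite !(mcoeffN, mcoeff_hcomp); case: ifP; rewrite ?oppr0.
Qed.

Lemma hcomp_sum z (T : Type) (r : seq T) (F : T -> S) :
  hcomp z (\sum_(i <- r) F i) = \sum_(i <- r) hcomp z (F i).
Proof. exact: (big_morph _ (hcompD z) (hcomp0 z)). Qed.

Lemma homogeneous0 z : homogeneous z 0.
Proof. by move=> m; rewrite mcoeff_msupp mcoeff0 eqxx. Qed.

Lemma homogeneousD z p q : homogeneous z p -> homogeneous z q -> homogeneous z (p + q).
Proof.
move=> hp hq; rewrite -(hcomp_id hp) -(hcomp_id hq) -hcompD.
exact: hcomp_homogeneous.
Qed.

Lemma homogeneous_sum z (T : Type) (r : seq T) (F : T -> S) :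
  (forall i, homogeneous z (F i)) -> homogeneous z (\sum_(i <- r) F i).
Proof.
move=> hF; apply: (big_ind (homogeneous z)) => [||i _]; last exact: hF.
  exact: homogeneous0.
by move=> p q; apply: homogeneousD.
Qed.

Lemma homogeneousM z e p q : homogeneous z p -> homogeneous e q -> homogeneous (z + e) (p * q).
Proof.
move=> hp hq m /msuppM_le /allpairsP[[m1 m2] /= [/hp-> /hq-> ->]].
by rewrite mdegD PoszD.
Qed.

Lemma homogeneousX m : homogeneous (mdeg m)%:Z 'X_[m].
Proof. by move=> m'; rewrite msuppX inE => /eqP->. Qed.

Lemma homogeneousZ z c p : homogeneous z p -> homogeneous z (c *: p).
Proof. by move=> hp m /msuppZ_le; apply: hp. Qed.

Lemma hcompM z e p q : homogeneous e q -> hcomp (z + e) (p * q) = hcomp z p * q.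
Proof.
move=> hq; rewrite [in LHS](mpolyE p) [in RHS](mpolyE p) mulr_suml !hcomp_sum mulr_suml.
apply: eq_bigr => m _.
have hm : homogeneous (mdeg m)%:Z (p@_m *: 'X_[m]) by apply/homogeneousZ/homogeneousX.
have [<-|nz] := eqVneq (mdeg m)%:Z z.
  by rewrite (hcomp_id hm) hcomp_id //; apply: homogeneousM.
rewrite (hcomp_neq hm nz) mul0r; apply: hcomp_neq (homogeneousM hm hq) _.
by rewrite (inj_eq (addIr _)).
Qed.

Definition row_hcomp a (d : 'I_a -> int) z (v : 'rV[S]_a) : 'rV[S]_a :=
  \row_c hcomp (z - d c) (v 0 c).

Definition homogeneous_mx a b (da : 'I_a -> int) (db : 'I_b -> int) (M : 'M[S]_(a, b)) :=
  forall r c, homogeneous (da r - db c) (M r c).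

Lemma row_hcompM a b da db z (v : 'rV[S]_a) (M : 'M[S]_(a, b)) :
  homogeneous_mx da db M -> row_hcomp da z v *m M = row_hcomp db z (v *m M).
Proof.
move=> hM; apply/rowP => c; rewrite !mxE hcomp_sum; apply: eq_bigr => r _.
by rewrite mxE -(hcompM _ _ (hM r c)) addrA subrK.
Qed.

Lemma homogeneous_mxM a b c da db dc (M : 'M[S]_(a, b)) (N : 'M[S]_(b, c)) :
  homogeneous_mx da db M -> homogeneous_mx db dc N -> homogeneous_mx da dc (M *m N).
Proof.
move=> hM hN r j; rewrite mxE; apply: homogeneous_sum => i.
have -> : da r - dc j = (da r - db i) + (db i - dc j) by rewrite addrA subrK.
exact: homogeneousM.
Qed.

Definition homogeneous_ideal (I : S -> Prop) : Prop :=
  [/\ I 0, forall p q, I p -> I q -> I (p + q), forall p q, I q -> I (p * q)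
    & forall z p, I p -> I (hcomp z p)].

Lemma ideal_opp I p : homogeneous_ideal I -> I p -> I (- p).
Proof. by case=> _ _ hM _ Ip; rewrite -mulN1r; apply: hM. Qed.

Lemma ideal_sub I p q : homogeneous_ideal I -> I p -> I q -> I (p - q).
Proof. by move=> hI Ip Iq; have [_ hD _ _] := hI; apply/hD => //; apply: ideal_opp. Qed.

Lemma ideal_sum I (T : Type) (r : seq T) (F : T -> S) :
  homogeneous_ideal I -> (forall i, I (F i)) -> I (\sum_(i <- r) F i).
Proof. by move=> [h0 hD _ _] hF; apply: big_ind. Qed.

Lemma ideal_congr I p q : homogeneous_ideal I -> I (p - q) -> I p <-> I q.
Proof.
move=> hI Ipq; have [_ hD _ _] := hI; split=> [Ip|Iq].
  have -> : q = p - (p - q) by rewrite opprB addrC subrK.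
  exact: ideal_sub.
by rewrite -(subrK q p); apply: hD.
Qed.

Local Notation deg C i := (@fr_deg n k C i).

(** Lift each row by exactness and keep its homogeneous component of the right
    degree, which still lifts the row because the differential is homogeneous. *)
Lemma lift_matrix (D : graded_free n k) i a (da : 'I_a -> int) (X : 'M[S]_(a, fr_rank D i)) :
  degree_preserving D -> homogeneous_mx da (deg D i) X ->
  (forall r, exists w : 'rV_(_), row r X = w *m fr_diff D i) ->
  exists2 Y, homogeneous_mx da (deg D i.+1) Y & X = Y *m fr_diff D i.
Proof.
move=> [_ hd] hX /fin_all_exists[w ew].
have hD : homogeneous_mx (deg D i.+1) (deg D i) (fr_diff D i).
  by move=> r c m /hd->; rewrite addrAC subrr add0r.
exists (\matrix_r row_hcomp (deg D i.+1) (da r) (w r)).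
  by move=> r c; rewrite !mxE; apply: hcomp_homogeneous.
apply/row_matrixP => r; rewrite row_mul rowK (row_hcompM _ _ hD) -ew.
by apply/rowP => c; rewrite !mxE hcomp_id.
Qed.

Lemma lift_augmentation J (D : graded_free n k) a (da : 'I_a -> int) (u : 'cV[S]_a) :
  homogeneous_ideal J -> degree_preserving D -> resolves J D ->
  (forall r, homogeneous (da r) (u r 0)) ->
  exists2 Y, homogeneous_mx da (deg D 0) Y &
    forall r, J ((Y *m fr_aug D) r 0 - u r 0).
Proof.
move=> hJ [ha _] [surj _ _] hu.
have /fin_all_exists[w ew] : forall r : 'I_a, exists w : 'rV[S]_(fr_rank D 0),
    J (u r 0 - (w *m fr_aug D) 0 0).
  by move=> r; apply: surj.
have hD : homogeneous_mx (deg D 0) (fun=> 0) (fr_aug D).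
  by move=> r c m; rewrite (ord1 c) => /ha->; rewrite subr0.
exists (\matrix_r row_hcomp (deg D 0) (da r) (w r)).
  by move=> r c; rewrite !mxE; apply: hcomp_homogeneous.
move=> r; have -> : (\matrix_r row_hcomp (deg D 0) (da r) (w r) *m fr_aug D) r 0 
    = hcomp (da r) ((w r *m fr_aug D) 0 0).
  transitivity ((row_hcomp (deg D 0) (da r) (w r) *m fr_aug D) 0 0).
    by rewrite !mxE; apply: eq_bigr => c _; rewrite !mxE.
  by rewrite (row_hcompM _ _ hD) mxE subr0.
rewrite -[u r 0](hcomp_id (hu r)) -[_ - _]opprK opprB -hcompN -hcompD.
by apply: ideal_opp => //; case: hJ => _ _ _; apply.
Qed.

Definition chain_map (C D : graded_free n k)
    (f : forall i, 'M[S]_(fr_rank C i, fr_rank D i)) : Prop :=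
  forall i, fr_diff C i *m f i = f i.+1 *m fr_diff D i.

(** The comparison theorem. Once f_i maps boundaries to boundaries, f_(i+1) can be
    chosen by lifting rows, and it maps boundaries to boundaries again because
    boundaries are the cycles of D. *)
Lemma lift_chain_map (I J : S -> Prop) (C D : graded_free n k) (q : S) (e : int) :
  homogeneous_ideal I -> homogeneous_ideal J ->
  degree_preserving C -> degree_preserving D -> resolves I C -> resolves J D ->
  homogeneous e q -> (forall p, I p -> J (q * p)) ->
  exists f : forall i, 'M[S]_(fr_rank C i, fr_rank D i),
    [/\ forall i, homogeneous_mx (fun r => deg C i r + e) (deg D i) (f i),
        forall v : 'rV_(fr_rank C 0), J ((v *m f 0 *m fr_aug D) 0 0 - q * (v *m fr_aug C) 0 0)
      & chain_map f].
Proof.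
move=> hI hJ dC dD rC rD he hIJ; have [_ exC0 exC] := rC; have [_ exD0 exD] := rD.
have dd i (w : 'rV_(fr_rank C i.+2)) : w *m fr_diff C i.+1 *m fr_diff C i = 0.
  by apply/exC; exists w.
pose good i (f : 'M[S]_(fr_rank C i, fr_rank D i)) :=
  homogeneous_mx (fun r => deg C i r + e) (deg D i) f /\
  forall w : 'rV_(fr_rank C i.+1), exists w', w *m fr_diff C i *m f = w' *m fr_diff D i.
have [f0 gf0 af0] : exists2 f0, good 0 f0 &
    forall v : 'rV_(fr_rank C 0), J ((v *m f0 *m fr_aug D) 0 0 - q * (v *m fr_aug C) 0 0).
  have [|f0 hf0 af0] := @lift_augmentation J D _ (fun r => deg C 0 r + e)
      (q *: fr_aug C) hJ dD rD.
    move=> r; rewrite mxE mulrC; apply: homogeneousM he => m.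
    by case: dC => [h _] /h.
  have af (v : 'rV_(fr_rank C 0)) : J ((v *m f0 *m fr_aug D) 0 0 - q * (v *m fr_aug C) 0 0).
    have -> : (v *m f0 *m fr_aug D) 0 0 - q * (v *m fr_aug C) 0 0 =
      \sum_r v 0 r * ((f0 *m fr_aug D) r 0 - (q *: fr_aug C) r 0).
      rewrite -mulmxA [X in X - _]mxE [X in _ - _ * X]mxE mulr_sumr -sumrB.
      by apply: eq_bigr => r _; rewrite [(q *: fr_aug C) r 0]mxE mulrBr mulrCA.
    by apply: ideal_sum => // r; case: hJ => _ _ hM _; apply: hM.
  exists f0 => //; split=> // w.
  apply/exD0/(ideal_congr hJ (af _)); apply: hIJ; apply/exC0.
  by exists w.
have step i (f : {f | good i f}) :
    {f' : {f' | good i.+1 f'} | fr_diff C i *m sval f = sval f' *m fr_diff D i}.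
  case: f => f [hf gf] /=; apply: constructive_indefinite_description.
  have [||Y hY eY] := @lift_matrix D i _ (fun r => deg C i.+1 r + e) (fr_diff C i *m f) dD.
  - apply: homogeneous_mxM hf => r c m.
    by case: dC => _ h /h->; rewrite opprD addrACA subrr addr0 addrAC subrr add0r.
  - by move=> r; have [w' ew'] := gf (delta_mx 0 r); exists w'; rewrite -ew' -mulmxA -rowE.
  have gY : good i.+1 Y.
    by split=> // w; apply/exD; rewrite -mulmxA -eY mulmxA dd mul0mx.
  by exists (exist _ Y gY).
pose F := fix F i : {f | good i f} :=
  if i is i'.+1 then sval (step i' (F i')) else exist _ f0 gf0.
exists (fun i => sval (F i)); split=> [i|//|i]; first by case: (F i) => ? [].
exact: (svalP (step i (F i))).
Qed.

(** A chain endomorphism over the zero map of S/I is nullhomotopic, h = s d + d s,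
    and the entries of d have no constant term. The homotopy is built one degree
    at a time, remembering only that h_i - s_i d_i has no constant term and is
    killed on the left by d_i, which is what the next step uses. *)
Lemma nullhomotopic_constant (I : S -> Prop) (C : graded_free n k)
    (h : forall i, 'M[S]_(fr_rank C i, fr_rank C i)) :
  resolves I C -> minimal C -> chain_map h ->
  (forall v : 'rV_(fr_rank C 0), I ((v *m h 0 *m fr_aug C) 0 0)) ->
  forall i r c, (h i r c)@_0%MM = 0.
Proof.
move=> [_ ex0 ex] minC ch h0 i.
have dd j : fr_diff C j.+1 *m fr_diff C j = 0.
  by apply/row_matrixP => r; rewrite row0 rowE mulmxA; apply/ex; exists (delta_mx 0 r).
pose cst a b (M : 'M[S]_(a, b)) := map_mx (mcoeff 0%MM) M.
have cstd j : cst _ _ (fr_diff C j) = 0.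
  by apply/matrixP => r c; rewrite !mxE minC.
have lift a j (X : 'M[S]_(a, fr_rank C j)) :
    (forall r, exists w : 'rV_(_), row r X = w *m fr_diff C j) ->
    exists s, X = s *m fr_diff C j.
  move=> /fin_all_exists[w ew]; exists (\matrix_r w r).
  by apply/row_matrixP => r; rewrite row_mul rowK.
suff [s [_ cs]] : exists s, fr_diff C i *m (h i - s *m fr_diff C i) = 0
    /\ cst _ _ (h i - s *m fr_diff C i) = 0.
  move=> r c; have -> : h i = (h i - s *m fr_diff C i) + s *m fr_diff C i by rewrite subrK.
  have : cst _ _ (h i - s *m fr_diff C i + s *m fr_diff C i) = 0.
    by rewrite /cst map_mxD map_mxM -!/(cst _ _ _) cs cstd mulmx0 addr0.
  by move/matrixP/(_ r c); rewrite !mxE.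
elim: i => [|i [s [ds cs]]].
  have [r|s es] := lift _ 0 (h 0); last by exists s; rewrite -es subrr mulmx0 /cst map_mx0.
  by apply/ex0; rewrite rowE.
have [r|s' es'] := lift _ i.+1 (h i.+1 - fr_diff C i *m s).
  by rewrite rowE; apply/ex; rewrite -mulmxA mulmxBl -ch -mulmxA -mulmxBr ds mulmx0.
have e : h i.+1 - s' *m fr_diff C i.+1 = fr_diff C i *m s by rewrite -es' subKr.
exists s'; rewrite e; split; first by rewrite mulmxA dd mul0mx.
by rewrite /cst map_mxM -!/(cst _ _ _) cstd mul0mx.
Qed.

Lemma chain_map_comp (C D E : graded_free n k) f g :
  @chain_map C D f -> @chain_map D E g -> chain_map (fun i => f i *m g i).
Proof. by move=> cf cg i; rewrite mulmxA cf -!mulmxA cg. Qed.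

(** Comparison maps f and g compose to the identity modulo the variables, so the
    row r of f has an entry with a constant term; as f is homogeneous, that entry
    joins generators of equal degrees. *)
Lemma minimal_resolution_degree (I : S -> Prop) (C D : graded_free n k) i
    (r : 'I_(fr_rank C i)) :
  homogeneous_ideal I -> minimal_graded_free_resolution I C ->
  minimal_graded_free_resolution I D ->
  exists c : 'I_(fr_rank D i), fr_deg c = fr_deg r.
Proof.
move=> hI [dC rC mC] [dD rD mD].
have h1 : homogeneous 0 (1 : S) by move=> m; rewrite msupp1 inE => /eqP->; rewrite mdeg0.
have hid p : I p -> I (1 * p) by rewrite mul1r.
have [f [hf af cf]] := lift_chain_map hI hI dC dD rC rD h1 hid.
have [g [hg ag cg]] := lift_chain_map hI hI dD dC rD rC h1 hid.
have /(_ i r r)/eqP : forall i r c, ((f i *m g i - 1%:M) r c)@_0%MM = 0.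
  apply: (nullhomotopic_constant rC mC) => [j|v].
    by rewrite mulmxBr mulmxBl mulmx1 mul1mx (chain_map_comp cf cg).
  have [_ hD _ _] := hI; have := hD _ _ (ag (v *m f 0%N)) (af v).
  rewrite !mul1r addrA subrK mulmxBr mulmx1 mulmxA mulmxBl.
  by rewrite [X in _ -> I X]mxE [X in _ -> I (_ + X)]mxE.
rewrite !mxE eqxx mcoeffB mcoeff1 eqxx subr_eq0 raddf_sum /= => /eqP e.
have [c nz] : exists c, (f i r c * g i c r)@_0%MM != 0.
  apply/existsP; apply: contra_eqT e => /existsPn h; rewrite big1 => [|c _].
    by rewrite eq_sym oner_eq0.
  by apply/eqP; rewrite -[_ == _]negbK h.
exists c; apply/esym/eqP; rewrite -subr_eq0.
have := hf i r c 0%MM; rewrite addr0 mdeg0 => -> //; rewrite mcoeff_msupp.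
by apply: contraNneq nz; rewrite rmorphM /= => ->; rewrite mul0r.
Qed.

End Homogeneous.

(** * The mapping cone *)

Section Cone.

Variables (n : nat) (k : fieldType).
Local Notation S := {mpoly k[n]}.
Implicit Types (C D : graded_free n k).

Section Construction.

Variables (C D : graded_free n k).
Variable g : forall i, 'M[S]_(fr_rank D i, fr_rank C i).
Variable e : int.

(** Row vectors of the cone in degree i.+1 are pairs (a, b) with a in C_(i+1) and b
    in D_i, whose image is (a d + b g, - b d). *)
Definition cone_rank i := if i is i'.+1 then (fr_rank C i + fr_rank D i')%N else fr_rank C 0.

Definition cone_deg i : 'I_(cone_rank i) -> int :=
  match i with
  | 0 => @fr_deg _ _ C 0
  | i'.+1 => fun r => match split r with
                      | inl a => fr_deg a
                      | inr b => fr_deg b + e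
                      end
  end.

Definition cone_diff i : 'M[S]_(cone_rank i.+1, cone_rank i) :=
  match i with
  | 0 => col_mx (fr_diff C 0) (g 0)
  | i'.+1 => block_mx (fr_diff C i'.+1) 0 (g i'.+1) (- fr_diff D i')
  end.

Definition cone := GradedFree cone_deg (fr_aug C) cone_diff.

Lemma cone_degree_preserving :
  degree_preserving C -> degree_preserving D ->
  (forall i, homogeneous_mx (fun r => fr_deg r + e) (@fr_deg _ _ C i) (g i)) ->
  degree_preserving cone.
Proof.
move=> [aC dC] [aD dD] hg; split=> [//|[|i] r c m] /=; rewrite !mxE.
  case: (split r) => a; first exact: dC.
  by move/hg => <-; rewrite [RHS]addrC subrK.
case: (split r) => a; rewrite !mxE; case: (split c) => b.
- exact: dC.
- by rewrite mxE msupp0.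
- by move/hg => <-; rewrite [RHS]addrC subrK.
by rewrite mxE (perm_mem (msuppN _)) => /dD->; rewrite addrAC.
Qed.

Lemma cone_minimal :
  minimal C -> minimal D -> (forall i r c, (g i r c)@_0%MM = 0) -> minimal cone.
Proof.
move=> mC mD mg [|i] r c /=; rewrite !mxE; first by case: (split r).
case: (split r) => a; rewrite !mxE; case: (split c) => b //.
  by rewrite mxE mcoeff0.
by rewrite mxE mcoeffN mD oppr0.
Qed.

Lemma cone_degrees i j :
  (exists r : 'I_(fr_rank cone i), fr_deg r = j) <->
  (exists r : 'I_(fr_rank C i), fr_deg r = j) \/
  (exists i' (r : 'I_(fr_rank D i')), i = i'.+1 /\ fr_deg r + e = j).
Proof.
case: i => [|i]; first by split=> [[r]|[[r]|[i' [r []]]]] //; [left|]; exists r.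
split=> [[r]|[[r er]|[i' [r [[->] er]]]]] /=.
- by case: (split r) => a <-; [left; exists a | right; exists i, a].
- by exists (lshift _ r); rewrite -[lshift _ r]/(unsplit (inl r)) unsplitK.
by exists (rshift _ r); rewrite -[rshift _ r]/(unsplit (inr r)) unsplitK.
Qed.

(** The ideal I is J + (t), and K is J : t, so t induces an injection from S/K to
    S/J with cokernel S/I. If (a, b) is a cycle then b is a boundary of D, in the
    lowest degree by that injectivity, and subtracting the boundary of a preimage
    of b leaves a cycle of C. *)
Lemma cone_resolves (I J K : S -> Prop) (t : S) :
  homogeneous_ideal J -> resolves J C -> resolves K D ->
  chain_map g ->
  (forall v : 'rV_(fr_rank D 0), J ((v *m g 0 *m fr_aug C) 0 0 - t * (v *m fr_aug D) 0 0)) ->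
  (forall p, J (t * p) <-> K p) ->
  (forall p, I p <-> exists a, J (p - t * a)) ->
  resolves I cone.
Proof.
move=> hJ [sC xC0 xC] [sD xD0 xD] cg ag JK IJ; have [J0 JD JM _] := hJ.
have ddC i : fr_diff C i.+1 *m fr_diff C i = 0.
  by apply/row_matrixP => r; rewrite row0 rowE mulmxA; apply/xC; exists (delta_mx 0 r).
have ddD i : fr_diff D i.+1 *m fr_diff D i = 0.
  by apply/row_matrixP => r; rewrite row0 rowE mulmxA; apply/xD; exists (delta_mx 0 r).
(* A cycle whose D-component is a boundary is itself a boundary. *)
have bound i (a : 'rV_(fr_rank C i.+1)) (w : 'rV_(fr_rank D i.+1)) :
    a *m fr_diff C i + w *m fr_diff D i *m g i = 0 ->
    exists u, row_mx a (w *m fr_diff D i) =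
      u *m block_mx (fr_diff C i.+1) 0 (g i.+1) (- fr_diff D i).
  rewrite -mulmxA cg mulmxA -mulmxDl => /xC[u eu].
  exists (row_mx u (- w)); rewrite mul_row_block mulmx0 add0r mulNmx mulmxN -eu.
  by rewrite mulNmx addrK opprK.
split=> [p|v|[|i] v] /=.
- by have [v Jv] := sC p; exists v; apply/IJ; exists 0; rewrite mulr0 subr0.
- split=> [/IJ[a Ja]|[w ->]].
    have [b Kb] := sD a; move/JK: Kb => Jb.
    have /xC0[u eu] : J (((v - b *m g 0) *m fr_aug C) 0 0).
      have -> : ((v - b *m g 0) *m fr_aug C) 0 0 =
         ((v *m fr_aug C) 0 0 - t * a) + (t * (a - (b *m fr_aug D) 0 0)
          - ((b *m g 0 *m fr_aug C) 0 0 - t * (b *m fr_aug D) 0 0)).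
        rewrite mulmxBl [LHS]mxE [X in _ + X = _]mxE mulrBr opprB.
        by rewrite [X in _ = _ + X]addrA subrK addrA subrK.
      by apply: JD => //; apply: ideal_sub.
    by exists (row_mx u b); rewrite mul_row_col -eu subrK.
  rewrite -[w]hsubmxK mul_row_col mulmxDl mxE; apply/IJ.
  exists ((rsubmx w *m fr_aug D) 0 0); rewrite -addrA; apply: JD; last exact: ag.
  by apply/xC0; exists (lsubmx w).
- split=> [|[w ->]]; last first.
    by rewrite -mulmxA mul_block_col ddC mul0mx addr0 mulNmx cg subrr col_mx0 mulmx0.
  rewrite -[v]hsubmxK mul_row_col; set a := lsubmx v; set b := rsubmx v => e0.
  have /xD0[w ew] : K ((b *m fr_aug D) 0 0).
    apply/JK/(ideal_congr hJ (ag b)).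
    have -> : b *m g 0 = - (a *m fr_diff C 0) by apply/eqP; rewrite -addr_eq0 addrC e0.
    by rewrite mulNmx mxE; apply: ideal_opp => //; apply/xC0; exists a.
  by rewrite ew; apply: bound; rewrite -ew.
split=> [|[w ->]]; last first.
  rewrite -mulmxA mulmx_block ddC !mul0mx !mulmx0 !addr0 !add0r !(mulNmx, mulmxN) opprK.
  by rewrite ddD cg subrr block_mx0 mulmx0.
rewrite -[v]hsubmxK mul_row_block mulmx0 add0r.
set a := lsubmx v; set b := rsubmx v.
rewrite -row_mx0 => /eq_row_mx[e0 /eqP].
rewrite mulmxN oppr_eq0 => /eqP/xD[w ew].
by rewrite ew; apply: bound; rewrite -ew.
Qed.

End Construction.
End Cone.

(** * Squarefree monomial ideals of forests *)

Section MonomialIdeals.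

Variables (n : nat) (k : fieldType).
Local Notation S := {mpoly k[n]}.
Implicit Types (FF : {set {set 'I_n}}) (F G H : {set 'I_n}) (p q : S) (m : 'X_{1..n}).

(** Membership read off the support; by [facet_idealE] these are the polynomial
    combinations of the monomials of the members of FF. *)
Definition monomial_ideal FF p : Prop :=
  forall m, m \in msupp p -> exists2 F, F \in FF & F \subset mvars m.

Lemma mvarsD m1 m2 : mvars (m1 + m2)%MM = mvars m1 :|: mvars m2.
Proof. by apply/setP => i; rewrite !inE mnmDE addn_gt0. Qed.

Lemma mvars_mesym1 F : mvars (mesym1 F) = F.
Proof. by apply/setP => i; rewrite !inE mnmE lt0b. Qed.

Lemma mesym1_le F m : F \subset mvars m -> (mesym1 F <= m)%MM.
Proof.
move=> /subsetP sF; apply/mnm_lepP => i; rewrite mnmE; case: (boolP (i \in F)) => // /sF.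
by rewrite inE.
Qed.

Lemma monomial_ideal_homogeneous FF : homogeneous_ideal (monomial_ideal FF).
Proof.
split=> [m|p q Ip Iq m|p q Iq m|z p Ip m].
- by rewrite mcoeff_msupp mcoeff0 eqxx.
- by move/msuppD_le; rewrite mem_cat => /orP[/Ip|/Iq].
- move/msuppM_le => /allpairsP[[m1 m2] /= [_ /Iq[F FFF sF] ->]].
  by exists F => //; rewrite mvarsD (subset_trans sF) ?subsetUr.
rewrite mcoeff_msupp mcoeff_hcomp; case: ifP => _; last by rewrite eqxx.
by rewrite -mcoeff_msupp => /Ip.
Qed.

Lemma monomial_ideal_min FF p : monomial_ideal (min_edges FF) p <-> monomial_ideal FF p.
Proof.
split=> Ip m /Ip[F FFF sF]; first by exists F => //; case/min_edgesP: FFF.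
by have [G Gm sGF] := min_edges_below FFF; exists G => //; apply: subset_trans sF.
Qed.

Lemma monomial_ideal_sum FF (c : {set 'I_n} -> S) :
  monomial_ideal FF (\sum_(F in FF) c F * 'X_[mesym1 F]).
Proof.
have hI := monomial_ideal_homogeneous FF; have [I0 ID IM _] := hI.
apply: (big_ind (monomial_ideal FF)) => // F FFF; apply: IM => m.
by rewrite msuppX inE => /eqP->; exists F; rewrite ?mvars_mesym1.
Qed.

Lemma facet_idealE (Gamma : {set {set 'I_n}}) p :
  facet_ideal k Gamma p <-> monomial_ideal (facets Gamma) p.
Proof.
have prodE F : \prod_(i in F) 'X_i = 'X_[mesym1 F] :> S.
  rewrite mpolyXE_id big_mkcond /=; apply: eq_bigr => i _.
  by rewrite mnmE; case: (i \in F).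
split=> [[c ->]|].
  by under eq_bigr do rewrite prodE; apply: monomial_ideal_sum.
move=> Ip; rewrite (mpolyE p) big_seq.
apply: (big_ind (facet_ideal k Gamma)) => [|_ _ [c ->] [d ->]|m /Ip[F FG sF]].
- by exists (fun=> 0); rewrite big1 // => F _; rewrite mul0r.
- by exists (fun F => c F + d F); rewrite -big_split; apply: eq_bigr => F _; rewrite mulrDl.
exists (fun G => if G == F then p@_m *: 'X_[m - mesym1 F] else 0).
rewrite (bigD1 F FG) /= eqxx [X in _ + X]big1 => [|G /andP[_ /negPf->]]; last by rewrite mul0r.
by rewrite addr0 prodE -scalerAl -mpolyXD submK // mesym1_le.
Qed.

(** Collect the terms divisible by the monomial of F; each of the others is
    divisible by the monomial of another member. *)
Lemma monomial_ideal_split FF F p : F \in FF ->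
  monomial_ideal FF p <-> exists a, monomial_ideal (FF :\ F) (p - 'X_[mesym1 F] * a).
Proof.
move=> FFF; have [I0 ID IM _] := monomial_ideal_homogeneous FF; split=> [Ip|[a Ia]].
  exists (\sum_(m <- msupp p | F \subset mvars m) p@_m *: 'X_[m - mesym1 F]).
  set a := \sum_(m <- _ | _) _; have -> : p - 'X_[mesym1 F] * a
      = \sum_(m <- msupp p | ~~ (F \subset mvars m)) p@_m *: 'X_[m].
    rewrite {1}(mpolyE p) (bigID (fun m => F \subset mvars m)) /= /a mulr_sumr addrAC.
    rewrite -sumrB big1 ?add0r // => m sF.
    by rewrite -scalerAr -mpolyXD addmC submK ?mesym1_le // subrr.
  rewrite big_seq_cond; have [J0 JD JM _] := monomial_ideal_homogeneous (FF :\ F).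
  apply: (big_ind (monomial_ideal (FF :\ F))) => // m /andP[mp nF].
  rewrite -mul_mpolyC; apply: JM => m'; rewrite msuppX inE => /eqP->.
  have [G GF sG] := Ip m mp; exists G => //; rewrite !inE GF andbT.
  by apply: contraNneq nF => <-.
rewrite -(subrK ('X_[mesym1 F] * a) p); apply: ID.
  by move=> m /Ia[G /setD1P[_ GF] sG]; exists G.
rewrite mulrC; apply: IM => m; rewrite msuppX inE => /eqP->.
by exists F; rewrite ?mvars_mesym1.
Qed.

Lemma mem_msuppXM u p m :
  m \in msupp ('X_[u] * p) <-> exists2 m', m' \in msupp p & m = (u + m')%MM.
Proof.
rewrite mulrC (perm_mem (msuppMX _ _)).
split=> [/mapP[m' m'p ->]|[m' m'p ->]]; first by exists m'.
exact: map_f.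
Qed.

Lemma monomial_ideal_colon FF F p :
  monomial_ideal (FF :\ F) ('X_[mesym1 F] * p) <-> monomial_ideal (contract FF F) p.
Proof.
split=> Ip m => [mp|/mem_msuppXM[m' m'p ->]].
  have [|G GF sG] := Ip (mesym1 F + m)%MM; first by apply/mem_msuppXM; exists m.
  by exists (G :\: F); [exact: imset_f | rewrite mvarsD mvars_mesym1 -subDset in sG].
have [_ /imsetP[G GF ->] sG] := Ip _ m'p; exists G => //.
by rewrite mvarsD mvars_mesym1 -subDset.
Qed.

(** The members other than F avoid v, so they do not need the variable x_v in
    order to divide. *)
Lemma monomial_ideal_colon_free FF F v p : free_vertex FF F v ->
  monomial_ideal (contract FF F) p -> monomial_ideal (FF :\ F) ('X_[mesym1 (F :\ v)] * p).
Proof.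
move=> [vF fv] Ip m /mem_msuppXM[m' /Ip[_ /imsetP[G /setD1P[nGF GF] ->] sG] ->].
exists G; rewrite ?inE ?nGF // mvarsD mvars_mesym1; apply/subsetP => x xG.
have nxv : x != v by apply: contraNneq nGF => e; rewrite (fv _ GF) // -e.
have := subsetP sG x; rewrite !inE nxv xG; case: (x \in F) => //=.
by apply.
Qed.

Lemma mesym1D1 F v : v \in F -> 'X_[mesym1 F] = 'X_v * 'X_[mesym1 (F :\ v)] :> S.
Proof.
move=> vF; rewrite -mpolyXD; congr 'X_[_]; apply/mnmP => i; rewrite mnmDE !mnmE !inE.
by rewrite (eq_sym i); have [<-|] := eqVneq v i; rewrite ?vF.
Qed.

(** The minimal resolution of the zero module. *)
Definition unit_resolution : graded_free n k :=
  @GradedFree n k (fun=> 0%N) (fun _ _ => 0) 0 (fun=> 0).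

Lemma unit_resolutionP (I : S -> Prop) :
  (forall p, I p) -> minimal_graded_free_resolution I unit_resolution.
Proof.
move=> II; split.
- by split=> [[]|? []].
- split=> [p|v|i v]; first by exists 0.
    by split=> // _; exists 0; rewrite !thinmx0.
  by split=> _; [exists 0 |]; rewrite !thinmx0.
by move=> i [].
Qed.

(** The minimal resolution of S itself. *)
Definition free_resolution : graded_free n k :=
  @GradedFree n k (fun i => (i == 0%N) : nat) (fun _ _ => 0) (const_mx 1) (fun=> 0).

Lemma free_resolutionP (I : S -> Prop) :
  (forall p, I p <-> p = 0) -> minimal_graded_free_resolution I free_resolution.
Proof.
move=> I0; split.
- split=> [r m|i r c m] /=; last by rewrite mxE msupp0.
  by rewrite mxE msupp1 inE => /eqP->; rewrite mdeg0.
- have aug (v : 'rV[S]_1) : (v *m const_mx 1 : 'M_1) 0 0 = v 0 0.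
    by rewrite mxE big_ord1 mxE mulr1.
  split=> [p|v|i v] /=.
  + by exists (const_mx p); apply/I0; rewrite aug mxE subrr.
  + split=> [/I0|[w ->]]; last by apply/I0; rewrite mulmx0 aug mxE.
    rewrite aug => v0; exists 0; rewrite mulmx0.
    by apply/rowP => c; rewrite (ord1 c) v0 mxE.
  by split=> _; [exists 0; rewrite mulmx0; exact: thinmx0 | rewrite mulmx0].
by move=> i r c /=; rewrite mxE mcoeff0.
Qed.

(** Induction on the number of members by the mapping cone along a leaf of the
    minimal members; [covered_rec] matches the generators of the cone. *)
Theorem forest_resolution FF : forest FF ->
  exists2 C, minimal_graded_free_resolution (monomial_ideal FF) C &
    forall i j, (exists r : 'I_(fr_rank C i), fr_deg r = j) <->
                exists2 A, covered FF i A & j = #|A|%:Z.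
Proof.
have [w] := ubnP #|FF|; elim: w FF => // w IH FF ltw fF.
have [F0|F0] := boolP (set0 \in FF).
  exists unit_resolution.
    by apply: unit_resolutionP => p m _; exists set0; rewrite ?sub0set.
  by move=> i j; split=> [[[]]//|[A /(covered_empty_edge F0)]].
have [->|FF0] := eqVneq FF set0.
  exists free_resolution.
    apply: free_resolutionP => p; split=> [Ip|->]; last first.
      by case: (monomial_ideal_homogeneous set0).
    apply/mpolyP => m; rewrite mcoeff0; apply/eqP; rewrite mcoeff_eq0.
    by apply/negP => /Ip[F]; rewrite inE.
  move=> i j; split=> [[r <-]|[A [[|G s] [[us sF irr abs] <- <-]] ->]].
  - case: i r => [|i] r; last by case: r.
    exists set0; last by rewrite cards0.
    by exists [::]; rewrite big_nil; split=> //; split=> // H; rewrite inE.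
  - by exists ord0; rewrite big_nil cards0.
  by have := sF G (mem_head _ _); rewrite inE.
have [F [v [Fm fv fd fc [ltd ltc]]]] := forest_elimination fF F0 FF0.
have [C [dC rC mC] bC] := IH _ (leq_trans ltd ltw) fd.
have [D [dD rD mD] bD] := IH _ (leq_trans ltc ltw) fc.
set J := monomial_ideal (min_edges FF :\ F) in dC rC mC.
set K := monomial_ideal (contract (min_edges FF) F) in dD rD mD.
have hJ : homogeneous_ideal J by apply: monomial_ideal_homogeneous.
have hK : homogeneous_ideal K by apply: monomial_ideal_homogeneous.
have hq := @homogeneousX n k (mesym1 (F :\ v)); rewrite mdeg_mesym1 in hq.
have KJ p : K p -> J ('X_[mesym1 (F :\ v)] * p) by apply: monomial_ideal_colon_free.
have [f [hf af cf]] := lift_chain_map hK hJ dD dC rD rC hq KJ.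
have vF : v \in F by case: fv.
have cF : #|F|%:Z = #|F :\ v|%:Z + 1 by rewrite (cardsD1 v) vF PoszD addrC.
(* Multiplying by x_v last makes the cone minimal. *)
pose g i := 'X_v *: f i.
have hg i : homogeneous_mx (fun r => fr_deg r + #|F|%:Z) (@fr_deg _ _ C i) (g i).
  move=> r c; rewrite mxE mulrC.
  have -> : fr_deg r + #|F|%:Z - fr_deg c = (fr_deg r + #|F :\ v|%:Z - fr_deg c) + 1.
    by rewrite cF [X in X - _]addrA [LHS]addrAC.
  by apply: homogeneousM (hf i r c) _ => m; rewrite msuppX inE => /eqP->; rewrite mdeg1.
exists (cone g #|F|%:Z); first split.
- exact: cone_degree_preserving.
- apply: (@cone_resolves n k C D g #|F|%:Z _ J K 'X_[mesym1 F]) => //.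
  + by move=> i; rewrite -scalemxAr cf scalemxAl.
  + move=> u; rewrite (mesym1D1 vF) -scalemxAr -scalemxAl mxE -mulrA -mulrBr.
    by case: hJ => _ _ JM _; apply: JM.
  + by move=> p; apply: monomial_ideal_colon.
  by move=> p; rewrite -(monomial_ideal_split _ Fm); apply: iff_sym; apply: monomial_ideal_min.
- apply: cone_minimal => // i r c; rewrite mxE rmorphM /= mcoeffX.
  by rewrite -mdeg_eq0 mdeg1 mul0r.
move=> i j; split.
  case/cone_degrees => [/bC[A cA ->]|[i' [r [-> <-]]]].
    by exists A => //; apply/covered_min/(covered_rec _ _ fv Fm); left.
  have [B cB ->] : exists2 B, covered (contract (min_edges FF) F) i' B & fr_deg r = #|B|%:Z.
    by apply/bD; exists r.
  have [dFB cFB] := covered_extend fv Fm cB.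
  exists (F :|: B); first exact/covered_min.
  by rewrite cardsU disjoint_setI0 // cards0 subn0 addnC PoszD.
case=> A /covered_min/(covered_rec _ _ fv Fm)[cA|[i' [B [-> -> dFB cB]]]] ->; apply/cone_degrees.
  by left; apply/bC; exists A.
right; have /bD[r er] :
    exists2 B', covered (contract (min_edges FF) F) i' B' & #|B|%:Z = #|B'|%:Z.
  by exists B.
exists i', r; split=> //.
by rewrite er cardsU disjoint_setI0 // cards0 subn0 addnC PoszD.
Qed.

End MonomialIdeals.

(** * Simplicial complexes and Betti numbers *)

Section Complexes.

Variable T : finType.
Implicit Types (A F G H : {set T}) (FF Gamma Delta : {set {set T}}) (s : seq {set T}).

Local Notation cup s := (\bigcup_(G <- s) G).

Lemma facetsP Gamma F :
  reflect (F \in Gamma /\ forall G, G \in Gamma -> F \subset G -> G = F) (F \in facets Gamma).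
Proof. by rewrite inE; apply: maxsetP. Qed.

Lemma facets_anti Gamma F G :
  F \in facets Gamma -> G \in facets Gamma -> F \subset G -> F = G.
Proof. by move=> /facetsP[_ mF] /facetsP[GG _] /(mF _ GG). Qed.

Lemma facets_generated FF :
  (forall F G, F \in FF -> G \in FF -> F \subset G -> F = G) ->
  facets (generated FF) = FF.
Proof.
move=> anti; apply/setP => F; apply/facetsP/idP => [[]|FFF].
  rewrite inE => /exists_inP[G GF sFG] mF; rewrite -(mF G _ sFG) //.
  by rewrite inE; apply/exists_inP; exists G.
split=> [|G]; first by rewrite inE; apply/exists_inP; exists F.
rewrite inE => /exists_inP[H HF sGH] sFG.
apply/eqP; rewrite eqEsubset sFG andbT.
by rewrite (anti F H) // (subset_trans sFG).
Qed.

Lemma facets_induced Gamma A :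
  facets (induced Gamma A) = [set F in facets Gamma | F \subset A].
Proof.
apply: facets_generated => F G; rewrite !inE => /andP[mF _] /andP[mG _].
by apply: (@facets_anti Gamma); rewrite inE.
Qed.

Lemma simplicial_forest_forest V Gamma : simplicial_forest V Gamma -> forest (facets Gamma).
Proof.
move=> [_ hl] GG sGG GG0.
have fG : facets (generated GG) = GG.
  by apply: facets_generated => F G /(subsetP sGG) mF /(subsetP sGG); apply: facets_anti.
have [||F] := hl (generated GG); first split.
- split=> [F|F G|v].
  + rewrite inE => /exists_inP[G GGG sFG]; apply: subset_trans sFG _.
    by rewrite /vertices fG (bigcup_max G).
  + rewrite !inE => /exists_inP[H HG sFH] sGF; apply/exists_inP; exists H => //.
    exact: subset_trans sFH.
  rewrite /vertices fG => /bigcupP[F FG vF]; rewrite inE; apply/exists_inP.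
  by exists F; rewrite ?sub1set.
- by rewrite fG.
- case/set0Pn: GG0 => F FG; apply/set0Pn; exists F.
  by rewrite inE; apply/exists_inP; exists F.
by rewrite /leaf fG => lF; exists F.
Qed.

Lemma minimal_coverP Delta s :
  minimal_facet_cover Delta [set F in s] <->
  [/\ {subset s <= facets Delta}, irredundant s & cup s = vertices Delta].
Proof.
split=> [[[sD cD] mD]|[sD irr cs]].
  have {}sD : {subset s <= facets Delta} by move=> F Fs; apply: (subsetP sD); rewrite inE.
  split=> //.
    move=> F Fs; pose others := \bigcup_(G in [set G in s] :\ F) G.
    have [|/subsetPn[x xF nx]] := boolP (F \subset others).
      move=> sF; case: (mD ([set G in s] :\ F)); first by rewrite properD1 ?inE.
      split=> [|v /cD[G]].
        by apply/subsetP => G; rewrite !inE => /andP[_ /sD]; rewrite inE.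
      have [->|nGF Gs vG] := eqVneq G F; last by exists G; rewrite // in_setD1 nGF.
      by move=> _ /(subsetP sF)/bigcupP[H]; exists H.
    exists x => // G Gs xG; apply/eqP; apply: contraNT nx => nGF.
    by apply/bigcupP; exists G => //; rewrite !inE nGF.
  apply/setP => x; apply/in_cup/bigcupP => [[F /sD]|[F FD xF]]; first by exists F.
  by have [|G] := cD x; [apply/bigcupP; exists F | rewrite inE; exists G].
split; first split.
- by apply/subsetP => F; rewrite inE => /sD.
- by move=> v; rewrite -cs => /in_cup[F Fs vF]; exists F; rewrite ?inE.
move=> D' /properP[sD' [F]]; rewrite inE => Fs FD' [_ cD'].
have [x xF px] := irr F Fs; have [|G GD xG] := cD' x.
  by apply/bigcupP; exists F => //; apply: sD.
have Gs : G \in s by have := subsetP sD' _ GD; rewrite inE.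
by move: FD'; rewrite -(px _ Gs xG) GD.
Qed.

(** In the antichain of facets, a facet outside s cannot contain the last member of
    s, so absorption always happens strictly before the end. *)
Lemma well_orderedP Delta s :
  well_ordered_facet_cover Delta s <->
  ordered_cover (facets Delta) s /\ cup s = vertices Delta.
Proof.
split=> [[us /minimal_coverP[sD irr cs] ord]|[[us sD irr abs] cs]].
  split=> //; split=> // H HD _; have [Hs|nHs] := boolP (H \in s).
    exact: absorbed_mem Hs _.
  by have [i lti h] := ord _ HD nHs; apply/absorbedP; exists i => //; apply: ltnW.
split=> //; first exact/minimal_coverP.
move=> H HD nHs; have /absorbedP[i lti h] : absorbed H s.
  by apply: abs => //; rewrite cs; apply: (bigcup_max H).
exists i => //; rewrite ltn_neqAle lti andbT; apply: contraNneq nHs => e.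
have Gs := mem_nth set0 lti; move: h; rewrite drop_oversize ?e // big_nil setU0.
by move/(facets_anti (sD _ Gs) HD) => <-.
Qed.

Lemma induced_coverP Gamma A s :
  well_ordered_facet_cover (induced Gamma A) s <->
  ordered_cover (facets Gamma) s /\ cup s = vertices (induced Gamma A).
Proof.
rewrite well_orderedP facets_induced.
have [e|ne] := eqVneq (cup s) (vertices (induced Gamma A)); last first.
  by split=> -[_ e]; rewrite e eqxx in ne.
have cA : cup s \subset A.
  rewrite e /vertices facets_induced; apply/bigcupsP => F; by rewrite inE => /andP[].
split=> -[[us sF irr abs] _]; split=> //; split=> //.
- by move=> F /sF; rewrite inE => /andP[].
- by move=> H HF sH; apply: abs => //; rewrite inE HF (subset_trans sH).
- by move=> F Fs; rewrite inE sF // (subset_trans (mem_cup Fs)).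
by move=> H; rewrite inE => /andP[HF _]; apply: abs.
Qed.

Lemma vertices_induced_cup Gamma s :
  {subset s <= facets Gamma} -> vertices (induced Gamma (cup s)) = cup s.
Proof.
move=> sF; apply/eqP; rewrite eqEsubset /vertices facets_induced; apply/andP; split.
  by apply/bigcupsP => F; rewrite inE => /andP[].
apply/subsetP => x /in_cup[F Fs xF]; apply/bigcupP; exists F => //.
by rewrite inE sF // mem_cup.
Qed.

Lemma coveredP Gamma i A :
  covered (facets Gamma) i A <->
  exists s, [/\ well_ordered_facet_cover (induced Gamma A) s,
               vertices (induced Gamma A) = A & size s = i].
Proof.
split=> [[s [os cs ss]]|[s [/induced_coverP[os cs] vA ss]]]; last first.
  by exists s; rewrite cs vA.
have [_ sF _ _] := os; have vA := vertices_induced_cup sF; rewrite cs in vA.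
by exists s; split=> //; apply/induced_coverP; rewrite cs vA.
Qed.

End Complexes.

Section Betti.

Variables (n : nat) (k : fieldType).
Local Notation S := {mpoly k[n]}.

Lemma minimal_resolution_ext (I J : S -> Prop) C :
  (forall p, I p <-> J p) ->
  minimal_graded_free_resolution I C -> minimal_graded_free_resolution J C.
Proof.
move=> IJ [dC [sC x0 xC] mC]; split=> //; split=> // [p|v].
  by have [v Iv] := sC p; exists v; apply/IJ.
by rewrite -IJ.
Qed.

(** The value chosen by [betti] comes from some minimal resolution, which has the
    same generator degrees as C. *)
Lemma betti_neq0 (I : S -> Prop) C i j :
  homogeneous_ideal I -> minimal_graded_free_resolution I C ->
  betti I i j <> 0%N <-> exists r : 'I_(fr_rank C i), fr_deg r = j.
Proof.
move=> hI mC; have [|D [mD eD]] := epsilon_spec (inhabits 0%N)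
    (fun b => exists C : graded_free n k, minimal_graded_free_resolution I C
       /\ b = #|[set r : 'I_(fr_rank C i) | fr_deg r == j]|).
  by exists #|[set r : 'I_(fr_rank C i) | fr_deg r == j]|, C.
rewrite /betti eD; split=> [/eqP|[r er]].
  rewrite cards_eq0 => /set0Pn[r]; rewrite inE => /eqP <-.
  exact: minimal_resolution_degree mD mC.
have [c ec] := minimal_resolution_degree r hI mC mD.
apply/eqP; rewrite cards_eq0; apply/set0Pn; exists c.
by rewrite inE ec er.
Qed.

Lemma betti_forest V (Gamma : {set {set 'I_n}}) i j :
  simplicial_forest V Gamma ->
  betti (facet_ideal k Gamma) i j <> 0%N <->
  exists2 A, covered (facets Gamma) i A & j = #|A|%:Z.
Proof.
move=> /simplicial_forest_forest fG.
have [C mC bC] := forest_resolution k fG.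
have hM := monomial_ideal_homogeneous k (facets Gamma).
have IJ p := facet_idealE Gamma (p : S).
rewrite -bC; apply: betti_neq0.
  have [M0 MD MM Mh] := hM.
  by split=> [|p q|p q|z p]; rewrite !IJ //; [apply: MD|apply: MM|apply: Mh].
by apply: minimal_resolution_ext mC => p; apply: iff_sym.
Qed.

End Betti.

Lemma is_maximum_ext d (L : porderType d) (P Q : L -> Prop) m :
  (forall x, P x <-> Q x) -> is_maximum P m <-> is_maximum Q m.
Proof.
by move=> PQ; split=> -[Pm mx]; split=> [|x /PQ]; by [apply/PQ | apply: mx].
Qed.

Lemma squarefree_mesym1 n (m : 'X_{1..n}) : squarefree m -> m = mesym1 (mvars m).
Proof.
by move=> sq; apply/mnmP => i; rewrite mnmE inE; have := sq i; case: (m i) => [|[]].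
Qed.

Theorem corollary3p10 (n : nat) (k : fieldType) (Gamma : {set {set 'I_n}})
    (hGamma : simplicial_forest [set: 'I_n] Gamma) :
  [/\ (forall p : nat,
        is_pd (facet_ideal k Gamma) p <->
        is_maximum (fun s : nat => exists (A : {set 'I_n}) (Fs : seq {set 'I_n}),
          well_ordered_facet_cover (induced Gamma A) Fs /\ s = size Fs) p),
      (forall r : int,
        is_reg (facet_ideal k Gamma) r <->
        is_maximum (fun q : int =>
          exists (m : 'X_{1..n}) (Fs : seq {set 'I_n}),
            [/\ squarefree m,
                vertices (induced Gamma (mvars m)) = mvars m,
                well_ordered_facet_cover (induced Gamma (mvars m)) Fs
              & q = (mdeg m)%:Z - (size Fs)%:Z]) r)
    & (forall (T : finType) (V : {set T}) (Delta : {set {set T}}),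
        simplicial_forest V Delta ->
        forall Fs Gs : seq {set T},
          well_ordered_facet_cover Delta Fs ->
          well_ordered_facet_cover Delta Gs ->
          size Fs = size Gs)].
Proof.
split=> [p|r|T V Delta fD Fs Gs /well_orderedP[oF cF] /well_orderedP[oG cG]].
- apply: is_maximum_ext => i.
  split=> [[j /(betti_forest _ _ _ hGamma)[A cA _]]|[A [s [ws ->]]]].
    by have /coveredP[s [ws _ <-]] := cA; exists A, s.
  have [os cs] := (induced_coverP _ _ _).1 ws.
  exists #|\bigcup_(G <- s) G|%:Z; apply/(betti_forest _ _ _ hGamma).
  by exists (\bigcup_(G <- s) G) => //; exists s.
- apply: is_maximum_ext => q; split.
    move=> [i [j [/(betti_forest _ _ _ hGamma)[A cA ->] ->]]].
    have /coveredP[s [ws vA ss]] := cA; exists (mesym1 A), s.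
    rewrite mvars_mesym1 mdeg_mesym1 ss; split=> // x.
    by rewrite mnmE; case: (_ \in _).
  move=> [m [s [sq vm ws ->]]]; exists (size s), (mdeg m)%:Z; split=> //.
  apply/(betti_forest _ _ _ hGamma); exists (mvars m).
    by apply/coveredP; exists s.
  by rewrite {1}(squarefree_mesym1 sq) mdeg_mesym1.
apply: (covered_size_unique (A := vertices Delta) (simplicial_forest_forest fD)).
  by exists Fs.
by exists Gs.
Qed.
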